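(* Let $\varphi\in C^2(\mathbb{R},\mathbb{R})$ satisfy the transversality condition $(\mathcal{T}_\alpha)$ for some $\alpha>0$, and let $K\ll N$, $K,N\in 2^{\mathbb{N}}$. Then $$\left\Vert P_Ne^{\pm it\varphi(\nabla/i)}u_0\;P_Ke^{\pm it\varphi(\nabla/i)}v_0\right\Vert_{L^2_{t,x}(I\times\mathbb{T})}\lesssim_\varphi|I|^{1/2}\Vert P_Nu_0\Vert_{L^2(\mathbb{T})}\Vert P_Kv_0\Vert_{L^2(\mathbb{T})}$$ for all $u_0,v_0\in L^2(\mathbb{T})$, whenever $I\subseteq\mathbb{R}$ is a compact time interval with $|I|\gtrsim N^{-\alpha}$.
   Context: $\mathbb{T}=\mathbb{R}/2\pi\mathbb{Z}$ (the dimension is $n=1$); $2^{\mathbb{N}}$ denotes the dyadic numbers $2^j$, $j\in\mathbb{N}$. $e^{\pm it\varphi(\nabla/i)}$ is the Fourier multiplier operator on $\mathbb{T}$ with symbol $e^{\pm it\varphi(\xi)}$, $\xi\in\mathbb{Z}$. For dyadic $N$, the frequency projector $P_N$ is defined by $(P_Nf)\widehat{\ }(\xi)=1_{[N,2N)}(|\xi|)\hat f(\xi)$. The left-hand side is the $L^2_{t,x}$-norm of the pointwise product of the two functions; the signs $\pm$ may be chosen arbitrarily. Condition $(\mathcal{T}_\alpha)$, with $\alpha>0$: for both choices of the sign, $|\nabla\varphi(\xi_1)\pm\nabla\varphi(\xi_2)|\sim N^\alpha$ whenever $|\xi_1|\sim K$, $|\xi_2|\sim N$, $K\ll N$, $K,N\in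 2^{\mathbb{N}}$ (here $\nabla\varphi=\varphi'$). In this condition $|\xi_1|\sim K$ and $|\xi_2|\sim N$ refer to the dyadic frequency ranges, in particular $|\xi_1|\in[K,2K)$ and $|\xi_2|\in[N,2N)$. $A\lesssim B$ means $A\le CB$ for a constant $C>0$; for the asserted size $|\nabla\varphi(\xi_1)\pm\nabla\varphi(\xi_2)|\sim N^\alpha$, $A\sim B$ means $A\lesssim B$ and $B\lesssim A$ with constants independent of $\xi_1,\xi_2,K,N$. $K\ll N$ means $K\le cN$ for a fixed sufficiently small constant $c>0$, the same in $(\mathcal{T}_\alpha)$ and in the proposition. $|I|\gtrsim N^{-\alpha}$ means $|I|\ge c_0N^{-\alpha}$ for a fixed constant $c_0>0$. The implicit constant in the conclusion may depend on $\varphi$ (including $\alpha$ and the constants in $(\mathcal{T}_\alpha)$) and on $c_0$, but not on $K,N,I,u_0,v_0$. *)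

(* Defs.v *)
From HB Require Import structures.
From mathcomp Require Import all_boot all_order all_algebra.
From mathcomp Require Import complex.
From mathcomp Require Import all_classical all_reals all_analysis.

Set Implicit Arguments.
Unset Strict Implicit.
Unset Printing Implicit Defensive.

Import Order.TTheory GRing.Theory Num.Theory.
Import numFieldNormedType.Exports.

Local Open Scope classical_set_scope.
Local Open Scope ring_scope.
Local Open Scope complex_scope.

Section Torus.
Context {R : realType}.
Implicit Types (f g : R -> R[i]) (m : int -> R[i]) (xi : int).

Definition expi (theta : R) : R[i] := cos theta +i* sin theta.

Definition cmeasurable_fun d (X : measurableType d) (f : X -> R[i]) :=
  measurable_fun setT (fun x => complex.Re (f x)) /\
  measurable_fun setT (fun x => complex.Im (f x)).

Definition cintegral d (X : measurableType d)
    (mu : {measure set X -> \bar R}) (D : set X) (f : X -> R[i]) : R[i] :=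
  Rintegral mu D (fun x => complex.Re (f x)) +i*
  Rintegral mu D (fun x => complex.Im (f x)).

Definition L2norm d (X : measurableType d)
    (mu : {measure set X -> \bar R}) (D : set X) (f : X -> R[i]) : \bar R :=
  'N[mu]_(2%:E)[(fun x => (ComplexField.Normc.normc (f x))%:E) \_ D].

(* Functions on the torus R / 2 pi Z are 2 pi-periodic functions on R, and
   integration over the torus is integration over one period. *)
Definition torus : set R := `[0, 2 * pi[.

Definition normL2T f : \bar R := L2norm lebesgue_measure torus f.

Definition L2T f : Prop :=
  [/\ forall x, f (x + 2 * pi) = f x, cmeasurable_fun f & (normL2T f < +oo)%E].

Definition fourier_coef f xi : R[i] :=
  ((2 * pi)^-1)%:C *
  cintegral lebesgue_measure torus (fun x => f x * expi (- (xi%:~R * x))).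

(* [g] represents the image of [f] under the Fourier multiplier operator with
   symbol [m].  On L^2(T) this operator acts on almost-everywhere classes, so
   it is a relation between representatives. *)
Definition fourier_multiplier m f g : Prop :=
  L2T g /\ forall xi, fourier_coef g xi = m xi * fourier_coef f xi.

Definition freq_range (N : nat) : set int :=
  [set xi : int | (N <= `|xi|%N < 2 * N)%N].

(* P_N f has finitely many nonzero Fourier coefficients; it is represented by
   the trigonometric polynomial with these coefficients, which is defined
   everywhere. *)
Definition freq_proj (N : nat) f : R -> R[i] := fun x =>
  \sum_(xi \in freq_range N) fourier_coef f xi * expi (xi%:~R * x).

(* [U t] represents e^{+- i t phi(nabla / i)} u0 for every time [t]; the sign
   is + if [s = false] and - if [s = true]. *)
Definition propagation (s : bool) (phi : R -> R) (u0 : R -> R[i])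
    (U : R -> R -> R[i]) : Prop :=
  forall t, fourier_multiplier
    (fun xi => expi ((-1) ^+ s * (t * phi xi%:~R))) u0 (U t).

Definition dyadic (N : nat) : Prop := exists j : nat, N = (2 ^ j)%N.

(* K << N, that is K <= c N for a fixed constant c > 0. *)
Definition much_less (c : R) (K N : nat) : Prop := K%:R <= c * N%:R.

Definition C2 (phi : R -> R) : Prop :=
  [/\ forall x, derivable phi x 1, forall x, derivable (derive1 phi) x 1 &
      continuous (derive1n 2 phi)].

(* xi1 and xi2 are real; the bounds are uniform in K, N, xi1 and xi2. *)
Definition transversality (c alpha : R) (phi : R -> R) : Prop :=
  exists A B : R, [/\ 0 < A, 0 < B &
    forall K N : nat, dyadic K -> dyadic N -> much_less c K N ->
    forall xi1 xi2 : R,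
      K%:R <= `|xi1| < 2 * K%:R -> N%:R <= `|xi2| < 2 * N%:R ->
    forall s : bool,
      A * N%:R `^ alpha <= `|derive1 phi xi1 + (-1) ^+ s * derive1 phi xi2|
        <= B * N%:R `^ alpha].

End Torus.

(* Main.v *)
(* Both projected solutions are finite exponential sums.  Split the frequencies
   n of u and k of v according to their signs.  Expanding the square of a block
   and integrating in x leaves the pairs of (n, k), (n', k') with
   n + k = n' + k'.  For such pairs the mean value theorem, applied to
   y |-> +- phi y +- phi (n + k - y), and transversality separate the time
   frequencies +- phi n +- phi k by at least A N^alpha |n - n'|.  Replacing the
   indicator of I in time by a parabola of width ~ |I| dominating it on I gives
   a kernel O(|I| / |n - n'|^2), because |I| N^alpha is bounded below, and
   Schur's test concludes. *)

Require Import Defs.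
From mathcomp Require Import all_boot all_order all_algebra.
From mathcomp Require Import complex.
From mathcomp Require Import all_classical all_reals all_analysis.
From mathcomp Require Import measurable_realfun zify ring lra.

Import Order.TTheory GRing.Theory Num.Theory.
Import numFieldNormedType.Exports.

Set Implicit Arguments.
Unset Strict Implicit.
Unset Printing Implicit Defensive.

Local Open Scope classical_set_scope.
Local Open Scope ring_scope.

(** * Derivatives and the fundamental theorem of calculus *)

Lemma is_derive_continuous (R : realType) (f F : R -> R) :
  (forall x : R, is_derive x 1 F (f x)) -> continuous F.
Proof.
move=> dF x; apply: differentiable_continuous; apply/derivable1_diffP.
by have [] := dF x.
Qed.

Lemma FTC_derivable (R : realType) (f F : R -> R) (a b : R) :
  a < b -> continuous f -> (forall x : R, is_derive x 1 F (f x)) ->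
  (\int[lebesgue_measure]_(x in `[a, b]) (f x)%:E = (F b - F a)%:E)%E.
Proof.
move=> ab cf dF.
have cF : continuous F by exact: is_derive_continuous dF.
rewrite (@continuous_FTC2 _ f F)//.
- exact: continuous_subspaceT.
- split.
  + by move=> x _; have [] := dF x.
  + exact/cvg_at_right_filter/cF.
  + exact/cvg_at_left_filter/cF.
- by move=> x _; rewrite derive1E; have [_ ->] := dF x.
Qed.

Lemma is_derive_sum_fin (R : realType) (I : finType) (F : I -> R -> R) (dF : I -> R) (x : R) :
  (forall i, is_derive x 1 (F i) (dF i)) ->
  is_derive x 1 (fun y => \sum_i F i y) (\sum_i dF i).
Proof.
move=> h.
have -> : (fun y => \sum_i F i y) = \sum_i F i by apply/funext => y; rewrite fct_sumE.
elim/big_rec2: _ => [|i d y _ ih].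
  exact: is_derive_cst.
exact: is_deriveD.
Qed.


(** * Real harmonics and their integrals over one period *)

Section Calculus.
Context {R : realType}.
Implicit Types (A B th k tau x : R).

Lemma is_derive_affine k tau x : is_derive x 1 (fun y : R => k * y + tau) k.
Proof. by apply: is_derive_eq; rewrite addr0 /GRing.scale/= mulr1. Qed.

Lemma is_derive_mul (f g : R -> R) (x df dg : R) :
  is_derive x 1 f df -> is_derive x 1 g dg ->
  is_derive x 1 (fun y => f y * g y) (df * g x + f x * dg).
Proof.
move=> hf hg; apply: is_derive_eq (is_deriveM hf hg) _.
by rewrite /GRing.scale/= addrC mulrC.
Qed.

Lemma is_derive_add (f g : R -> R) (x df dg : R) :
  is_derive x 1 f df -> is_derive x 1 g dg ->
  is_derive x 1 (fun y => f y + g y) (df + dg).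
Proof. exact: is_deriveD. Qed.

Lemma is_derive_scale (f : R -> R) (x c df : R) :
  is_derive x 1 f df -> is_derive x 1 (fun y => c * f y) (c * df).
Proof. by move=> hf; exact: is_deriveZ. Qed.

(* Re ((A + i B) e^(i th)) *)
Definition harm A B th : R := A * cos th - B * sin th.

(** Differentiation multiplies A + i B by i k, and i (A + i B) = - (B - i A), hence the swapped
    amplitudes. *)
Lemma is_derive_harm A B k tau x :
  is_derive x 1 (fun y : R => harm A B (k * y + tau))
                (- k * harm B (- A) (k * x + tau)).
Proof.
have dk := is_derive_affine k tau x.
have dc := @is_derive1_comp _ cos (fun y => k * y + tau) _ _ _ (is_derive_cos _) dk.
have ds := @is_derive1_comp _ sin (fun y => k * y + tau) _ _ _ (is_derive_sin _) dk.
apply: is_derive_eq (is_deriveB (is_derive_scale A dc) (is_derive_scale B ds)) _.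
rewrite /harm; ring.
Qed.

Lemma harmN A B th : harm (- A) (- B) th = - harm A B th.
Proof. rewrite /harm; ring. Qed.

Lemma cos_addint (m : int) x : cos (x + m%:~R * (2 * pi)) = cos x :> R.
Proof.
rewrite [2 * pi]mulr_natl.
have key (n : nat) y : cos (y + n%:R * (pi *+ 2)) = cos y :> R.
  elim: n => [|n ih] in y *; first by rewrite mul0r addr0.
  by rewrite -natr1 mulrDl mul1r addrA cosD2pi ih.
case: m => n; first exact: key.
by rewrite NegzE mulrNz -(key n.+1) mulNr addrNK.
Qed.

Lemma sin_addint (m : int) x : sin (x + m%:~R * (2 * pi)) = sin x :> R.
Proof. by rewrite -!cosBpihalf addrAC cos_addint. Qed.

Lemma harm_addint A B (m : int) x : harm A B (x + m%:~R * (2 * pi)) = harm A B x.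
Proof. by rewrite /harm cos_addint sin_addint. Qed.

Lemma ler_norm_harm A B th e : `|A| <= e -> `|B| <= e -> `|harm A B th| <= 2 * e.
Proof.
move=> hA hB; rewrite /harm (le_trans (ler_normB _ _))// !normrM.
have hc : `|cos th| <= 1 by rewrite ler_norml cos_geN1 cos_le1.
have hs : `|sin th| <= 1 by rewrite ler_norml sin_geN1 sin_le1.
have := ler_wpM2l (normr_ge0 A) hc; have := ler_wpM2l (normr_ge0 B) hs.
lra.
Qed.

Lemma continuous_harm A B k tau : continuous (fun y : R => harm A B (k * y + tau)).
Proof. exact: is_derive_continuous (is_derive_harm A B k tau). Qed.

Lemma continuous_sum_fin (I : finType) (f : I -> R -> R) :
  (forall i, continuous (f i)) -> continuous (fun y => \sum_i f i y).
Proof.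
move=> h.
have -> : (fun y => \sum_i f i y) = \sum_i f i by apply/funext => y; rewrite fct_sumE.
elim/big_rec: _ => [|i d _ ih] x; first exact: cst_continuous.
exact: (continuousD (h i x) (ih x)).
Qed.

(** Orthogonality on the torus: a harmonic with nonzero integer frequency has a 2 pi-periodic
    primitive, so only the constant terms survive. *)
Lemma integral_torus_harm (P : finType) (A B : P -> R) (k : P -> int) (tau : P -> R) :
  (\int[lebesgue_measure]_(x in torus)
      (\sum_p harm (A p) (B p) ((k p)%:~R * x + tau p))%:E
   = (2 * pi * \sum_(p | k p == 0%R) harm (A p) (B p) (tau p))%:E)%E.
Proof.
have cf : continuous (fun x : R => \sum_p harm (A p) (B p) ((k p)%:~R * x + tau p)).
  by apply: continuous_sum_fin => p; exact: continuous_harm.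
rewrite /torus integral_itv_bndo_bndc; last first.
  apply/measurable_EFinP; apply: measurable_funTS; exact: continuous_measurable_fun.
pose F p (x : R) : R := if k p == 0 then harm (A p) (B p) (tau p) * x
  else (k p)%:~R^-1 * - harm (- B p) (A p) ((k p)%:~R * x + tau p).
have dF x : is_derive x 1 (fun x => \sum_p F p x)
    (\sum_p harm (A p) (B p) ((k p)%:~R * x + tau p)).
  apply: is_derive_sum_fin => p; rewrite /F; case: (boolP (k p == 0)) => kp.
    rewrite (eqP kp) mul0r add0r.
    exact: is_derive_eq (is_derive_scale _ (is_derive_id x 1)) (mulr1 _).
  apply: is_derive_eq (is_derive_scale _ (is_deriveN (is_derive_harm _ _ _ _ _))) _.
  by rewrite mulNr opprK mulKf ?intr_eq0// /harm; ring.
rewrite (FTC_derivable _ cf dF) ?mulr_gt0 ?pi_gt0//.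
congr EFin; rewrite -sumrB mulr_sumr [RHS]big_mkcond/=; apply: eq_bigr => p _.
rewrite /F; case: ifPn => kp; first ring.
by rewrite [X in harm _ _ X]addrC harm_addint mulr0 add0r subrr.
Qed.

End Calculus.

(** * The parabolic time weight and its Fourier transform *)

Section Weight.
Context {R : realType}.
Implicit Types (A B m L lam t e : R).

(** At least 3 / 4 for |t - m| <= L / 2, so 4 / 3 times it dominates the indicator of the interval
    of length L centred at m. *)
Definition parabola m L t : R := 1 - ((t - m) / L) ^+ 2.

(* Bounds the Fourier transform at lam of the parabola on [m - L, m + L]; as
   the parabola vanishes at the endpoints, integration by parts leaves no
   boundary term of order 1 / lam. *)
Definition kern L lam : R := if lam == 0 then 2 * L else
  8 * ((L * lam ^+ 2)^-1 + (L ^+ 2 * `|lam| ^+ 3)^-1).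

(** The weight is quadratic, so repeated integration by parts terminates and gives a closed form. A
    primitive is produced instead of an integral so that finite sums of such terms can be integrated
    at once. *)
Lemma parabola_primitive A B lam m L e : 0 < L -> `|A| <= e -> `|B| <= e ->
  exists2 F : R -> R,
    forall t : R, is_derive t 1 F (parabola m L t * harm A B (lam * t)) &
    `|F (m + L) - F (m - L)| <= kern L lam * e.
Proof.
move=> L0 hA hB.
have Ln0 : L != 0 by rewrite gt_eqF.
have dsq n t : is_derive t 1 (fun y : R => (y - m) ^+ n.+1) (n.+1%:R * (t - m) ^+ n).
  have d1 : is_derive t 1 (fun y : R => y - m) 1.
    exact: is_derive_eq (is_deriveB (is_derive_id t 1) (is_derive_cst m t 1)) (subr0 _).
  have -> : (fun y : R => (y - m) ^+ n.+1) = (fun y : R => y - m) ^+ n.+1.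
    by apply/funext => y; rewrite exprfctE.
  by apply: is_derive_eq (is_deriveX n.+1 d1) _; rewrite /GRing.scale/= mulr1.
rewrite /kern; case: eqVneq => [->|lam0].
  (* At [lam] = 0 the harmonic is the constant A, and the weight alone has mass 4 / 3 L <= 2 L. *)
  exists (fun t => A * ((t - m) ^+ 1 + - (3 * L ^+ 2)^-1 * (t - m) ^+ 3)).
    move=> t; apply: is_derive_eq (is_derive_scale _ (is_derive_add (dsq 0%N t)
      (is_derive_scale _ (dsq 2%N t)))) _.
    rewrite /parabola /harm mul0r cos0 sin0; field.
    by rewrite Ln0.
  have -> : A * ((m + L - m) ^+ 1 + - (3 * L ^+ 2)^-1 * (m + L - m) ^+ 3) -
    A * ((m - L - m) ^+ 1 + - (3 * L ^+ 2)^-1 * (m - L - m) ^+ 3) = 4 / 3 * L * A.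
    by field.
  have c0 : 0 <= 4 / 3 * L by lra.
  rewrite normrM (ger0_norm c0).
  have := ler_wpM2l (ltW L0) hA; have := mulr_ge0 (ltW L0) (le_trans (normr_ge0 _) hA); lra.
have dh A' B' t : is_derive t 1 (fun y : R => harm A' B' (lam * y))
    (- lam * harm B' (- A') (lam * t)).
  have := is_derive_harm A' B' lam 0 t; rewrite addr0.
  by under eq_fun do rewrite addr0.
pose s t := harm B (- A) (lam * t); pose c t := harm A B (lam * t).
have ds t : is_derive t 1 s (lam * c t).
  by apply: is_derive_eq (dh _ _ _) _; rewrite harmN mulrNN.
have dc t : is_derive t 1 c (- lam * s t) by exact: dh.
have dw t : is_derive t 1 (fun y => 1 + - L^-2 * (y - m) ^+ 2) (-2 * (t - m) / L^+2).
  have d0 : is_derive t 1 (fun=> 1 : R) (0 : R) by exact: is_derive_cst.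
  have d1 := is_derive_add d0 (is_derive_scale (- L^-2) (dsq 1%N t)).
  by apply: is_derive_eq d1 _; field.
(* With w the weight, the three terms are w s / lam, w' c / lam^2 and - w'' s / lam^3. *)
exists (fun t => lam^-1 * ((1 + - L^-2 * (t - m) ^+ 2) * s t)
  + (- 2 / (lam ^+ 2 * L ^+2) * ((t - m) ^+ 1 * c t) + 2 / (lam ^+ 3 * L ^+ 2) * s t)).
  move=> t.
  apply: is_derive_eq (is_derive_add (is_derive_scale _ (is_derive_mul (dw t) (ds t)))
    (is_derive_add (is_derive_scale _ (is_derive_mul (dsq 0%N t) (dc t)))
      (is_derive_scale _ (ds t)))) _.
  rewrite /parabola -/(c t) /=; field.
  by rewrite Ln0.
have hs t : `|s t| <= 2 * e by apply: ler_norm_harm => //; rewrite normrN.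
have hc t : `|c t| <= 2 * e by exact: ler_norm_harm.
set x := s (m + L) - s (m - L).
set y := c (m + L) + c (m - L).
set z := _ - _.
(* The w s / lam term is gone because w vanishes at m - L and m + L. *)
have -> : z = x * (2 / (lam ^+ 3 * L ^+ 2)) - y * (2 / (lam ^+ 2 * L)).
  by rewrite /z /x /y; field; rewrite Ln0.
have hx : `|x| <= 4 * e.
  by rewrite (le_trans (ler_normB _ _))//; have := hs (m + L); have := hs (m - L); lra.
have hy : `|y| <= 4 * e.
  by rewrite (le_trans (ler_normD _ _))//; have := hc (m + L); have := hc (m - L); lra.
clear z; move: x y hx hy => x y hx hy.
rewrite (le_trans (ler_normB _ _))// [`|x * _|]normrM [`|y * _|]normrM.
have -> : `|2 / (lam ^+ 3 * L ^+ 2)| = 2 * (L ^+ 2 * `|lam| ^+ 3)^-1.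
  by rewrite normrM normfV normrM !normrX (gtr0_norm L0) ger0_norm// [L ^+ 2 * _]mulrC.
have -> : `|2 / (lam ^+ 2 * L)| = 2 * (L * lam ^+ 2)^-1.
  rewrite normrM normfV normrM ger0_norm// [`|lam ^+ 2|]ger0_norm ?sqr_ge0//.
  by rewrite (gtr0_norm L0) [L * _]mulrC.
have p3 : 0 <= 2 * (L ^+ 2 * `|lam| ^+ 3)^-1.
  by rewrite mulr_ge0// invr_ge0 mulr_ge0 ?sqr_ge0 ?exprn_ge0.
have p2 : 0 <= 2 * (L * lam ^+ 2)^-1 by rewrite mulr_ge0// invr_ge0 mulr_ge0 ?sqr_ge0 ?ltW.
by have := ler_wpM2r p3 hx; have := ler_wpM2r p2 hy; lra.
Qed.

Lemma kernN L lam : kern L (- lam) = kern L lam.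
Proof. by rewrite /kern oppr_eq0 sqrrN normrN. Qed.

End Weight.

(** * Squared moduli of exponential sums *)

Section Squares.
Context {R : realType}.
Implicit Types (z w : R[i]) (th : R).

Definition sqnorm z : R := complex.Re z ^+ 2 + complex.Im z ^+ 2.

(* Real and imaginary part of z times the conjugate of w. *)
Definition cross_re z w : R := complex.Re z * complex.Re w + complex.Im z * complex.Im w.
Definition cross_im z w : R := complex.Im z * complex.Re w - complex.Re z * complex.Im w.

Lemma sqnorm_ge0 z : 0 <= sqnorm z.
Proof. by rewrite addr_ge0 ?sqr_ge0. Qed.

Lemma sqnormM z w : sqnorm (z * w) = sqnorm z * sqnorm w.
Proof. by case: z w => a b [c d]; rewrite /sqnorm /=; ring. Qed.

Lemma sqnorm_normc z : ComplexField.Normc.normc z = Num.sqrt (sqnorm z).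
Proof. by case: z. Qed.

Lemma expiD (x y : R) : expi (x + y) = expi x * expi y.
Proof.
rewrite /expi cosD sinD; congr (_ +i* _)%C; rewrite addrC.
by congr (_ + _); rewrite mulrC.
Qed.

Lemma ReD z w : complex.Re (z + w) = complex.Re z + complex.Re w.
Proof. by case: z w => a b []. Qed.

Lemma ImD z w : complex.Im (z + w) = complex.Im z + complex.Im w.
Proof. by case: z w => a b []. Qed.

Lemma sqnormD z w : sqnorm (z + w) <= 2 * (sqnorm z + sqnorm w).
Proof.
rewrite /sqnorm ReD ImD.
have := sqr_ge0 (complex.Re z - complex.Re w).
have := sqr_ge0 (complex.Im z - complex.Im w); nra.
Qed.

(** By the arithmetic-geometric mean inequality; the average of the squared moduli is the form to
    which [schur_test] applies. *)
Lemma cross_re_le z w : `|cross_re z w| <= (sqnorm z + sqnorm w) / 2.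
Proof.
case: z w => a b [c d]; rewrite /cross_re /sqnorm /= ler_norml.
have := sqr_ge0 (a - c); have := sqr_ge0 (b - d).
have := sqr_ge0 (a + c); have := sqr_ge0 (b + d).
by rewrite !expr2 => *; apply/andP; split; nra.
Qed.

Lemma cross_im_le z w : `|cross_im z w| <= (sqnorm z + sqnorm w) / 2.
Proof.
case: z w => a b [c d]; rewrite /cross_im /sqnorm /= ler_norml.
have := sqr_ge0 (a - d); have := sqr_ge0 (b - c).
have := sqr_ge0 (a + d); have := sqr_ge0 (b + c).
by rewrite !expr2 => *; apply/andP; split; nra.
Qed.

(** Expansion of S times its conjugate; the result being real, each term may be replaced by its real
    part, a [harm]. *)
Lemma sqnorm_sum_expi (P : finType) (z : P -> R[i]) (th : P -> R) :
  sqnorm (\sum_p z p * expi (th p)) =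
  \sum_(pq : P * P) harm (cross_re (z pq.1) (z pq.2)) (cross_im (z pq.1) (z pq.2))
                        (th pq.1 - th pq.2).
Proof.
have RS (f : P -> R[i]) : complex.Re (\sum_p f p) = \sum_p complex.Re (f p).
  by apply: (big_morph _ ReD).
have IS (f : P -> R[i]) : complex.Im (\sum_p f p) = \sum_p complex.Im (f p).
  by apply: (big_morph _ ImD).
rewrite /sqnorm RS IS !expr2 !big_distrlr/= !pair_big/= -big_split/=.
apply: eq_bigr => -[p q] _ /=.
rewrite /harm /cross_re /cross_im cosB sinB.
by case: (z p) (z q) => a b [c d] /=; ring.
Qed.

End Squares.

(** * Space-time integrals of exponential sums *)

Section Planar.
Context {R : realType}.

Lemma tonelli_rect (A B : set R) (f : R * R -> \bar R) :
  measurable A -> measurable B -> measurable_fun setT f -> (forall z, (0 <= f z)%E) ->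
  (\int[lebesgue_measure \x lebesgue_measure]_(z in A `*` B) f z =
   \int[lebesgue_measure]_(t in A) \int[lebesgue_measure]_(x in B) f (t, x))%E.
Proof.
move=> mA mB mf f0; rewrite integral_mkcond fubini_tonelli1; first last.
- by move=> z; rewrite erestrict_ge0.
- apply/(measurable_restrictT f (measurableX mA mB)); exact: measurable_funTS.
rewrite [RHS]integral_mkcond; apply: eq_integral => t _.
rewrite /fubini_F patchE; case: ifPn => tA.
  rewrite [RHS]integral_mkcond; apply: eq_integral => x _.
  by rewrite !patchE in_setX tA.
apply: integral0_eq => x _.
by rewrite patchE in_setX (negbTE tA).
Qed.

Lemma measurable_sqnorm_sum_expi (P : finType) (z : P -> R[i]) (th : P -> R * R -> R) :
  (forall p, measurable_fun setT (th p)) ->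
  measurable_fun setT (fun v => sqnorm (\sum_p z p * expi (th p v))).
Proof.
move=> mth; under eq_fun do rewrite sqnorm_sum_expi.
apply: measurable_sum => -[p q] /=.
have mpq : measurable_fun setT (fun v => th p v - th q v) by exact: measurable_funB.
rewrite /harm; apply: measurable_funB; apply: measurable_funM => //.
  by apply: measurableT_comp mpq; apply: continuous_measurable_fun; exact: continuous_cos.
by apply: measurableT_comp mpq; apply: continuous_measurable_fun; exact: continuous_sin.
Qed.

Lemma measurable_phase (k l : R) :
  measurable_fun setT (fun v : R * R => k * v.2 + l * v.1).
Proof. by apply: measurable_funD; apply: measurable_funM. Qed.

Lemma continuous_parabola (m L : R) : continuous (parabola m L).
Proof.
have d1 (t : R) : is_derive t 1 (fun y : R => L^-1 * y + - (L^-1 * m)) L^-1.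
  exact: is_derive_affine.
have dw (t : R) := is_deriveB (is_derive_cst (1 : R) t 1) (is_derive_mul (d1 t) (d1 t)).
have -> : parabola m L =
  cst 1 - (fun y => (L^-1 * y + - (L^-1 * m)) * (L^-1 * y + - (L^-1 * m))).
  by apply/funext => t; rewrite /parabola !fctE /=; ring.
exact: is_derive_continuous dw.
Qed.

(** Integration in x leaves the pairs of equal spatial frequency. The resulting function of t is
    nonnegative, so the sharp time cutoff can be replaced by the larger parabola, whose Fourier
    transform is controlled by [kern]. *)
Lemma planar_bound (P : finType) (z : P -> R[i]) (xi : P -> int) (lam : P -> R) (a b : R) :
  a < b ->
  (\int[lebesgue_measure \x lebesgue_measure]_(v in `[a, b] `*` torus)
     (sqnorm (\sum_p z p * expi ((xi p)%:~R * v.2 + lam p * v.1)))%:E <=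
   (4 / 3 * (2 * pi) * \sum_(pq : P * P | xi pq.1 == xi pq.2)
      kern (b - a) (lam pq.1 - lam pq.2) * ((sqnorm (z pq.1) + sqnorm (z pq.2)) / 2))%:E)%E.
Proof.
move=> ab.
set L := b - a; have L0 : 0 < L by rewrite subr_gt0.
pose m := (a + b) / 2.
have mG : measurable_fun setT (fun v : R * R =>
    (sqnorm (\sum_p z p * expi ((xi p)%:~R * v.2 + lam p * v.1)))%:E).
  apply/measurable_EFinP; apply: measurable_sqnorm_sum_expi => p; exact: measurable_phase.
have mT : measurable (torus : set R) by exact: measurable_itv.
rewrite tonelli_rect//; last by move=> v; rewrite lee_fin sqnorm_ge0.
pose A (pq : P * P) := cross_re (z pq.1) (z pq.2).
pose B (pq : P * P) := cross_im (z pq.1) (z pq.2).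
pose mu (pq : P * P) := lam pq.1 - lam pq.2.
pose H t := \sum_(pq : P * P | xi pq.1 == xi pq.2) harm (A pq) (B pq) (mu pq * t).
have innerE t : (\int[lebesgue_measure]_(x in torus)
   (sqnorm (\sum_p z p * expi ((xi p)%:~R * x + lam p * t)))%:E = (2 * pi * H t)%:E)%E.
  under eq_integral do rewrite sqnorm_sum_expi.
  transitivity (\int[lebesgue_measure]_(x in torus)
     (\sum_pq harm (A pq) (B pq) ((xi pq.1 - xi pq.2)%:~R * x + mu pq * t))%:E)%E.
    apply: eq_integral => x _; congr EFin; apply: eq_bigr => pq _.
    by rewrite /mu rmorphB/=; congr harm; ring.
  rewrite (integral_torus_harm _ _ (fun pq => xi pq.1 - xi pq.2) (fun pq => mu pq * t)).
  by congr (_ * _)%:E; apply: eq_bigl => pq; rewrite subr_eq0.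
have pi2 : 0 < 2 * pi :> R by rewrite mulr_gt0 ?pi_gt0.
(* The single harmonics have no sign; [H] is nonnegative as the x-integral of a square, up to the
   factor 2 pi. *)
have H0 t : 0 <= H t.
  rewrite -(pmulr_rge0 _ pi2) -lee_fin -innerE.
  by apply: integral_ge0 => x _; rewrite lee_fin sqnorm_ge0.
under eq_integral do rewrite innerE.
pose w := parabola m L.
have cH : continuous H.
  rewrite /H; under eq_fun do rewrite big_mkcond/=.
  apply: continuous_sum_fin => pq; case: (xi pq.1 == xi pq.2); last exact: cst_continuous.
  by have := @continuous_harm R (A pq) (B pq) (mu pq) 0; under eq_fun do rewrite addr0.
have cwH : continuous (fun t => 4 / 3 * (2 * pi) * (w t * H t)).
  move=> t; apply: cvgM; first exact: cvg_cst.
  apply: cvgM; [exact: continuous_parabola | exact: cH].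
have w0 t : `[m - L, m + L]%classic t -> 0 <= w t.
  rewrite /= in_itv/= => /andP[h1 h2]; rewrite /w /parabola expr_div_n subr_ge0.
  by rewrite ler_pdivrMr ?exprn_gt0// mul1r; nra.
(* First insert the weight on [a, b], then enlarge the interval to [m - L, m + L], where the weight
   is still nonnegative. *)
apply: (@le_trans _ _ (\int[lebesgue_measure]_(t in `[(m - L)%R, (m + L)%R])
    (4 / 3 * (2 * pi) * (w t * H t))%:E)%E).
  apply: (@le_trans _ _ (\int[lebesgue_measure]_(t in `[a, b])
    (4 / 3 * (2 * pi) * (w t * H t))%:E)%E).
    apply: ge0_le_integral => //.
    - by move=> t _; rewrite lee_fin mulr_ge0// ltW.
    - apply/measurable_EFinP; apply: measurable_funTS; apply: continuous_measurable_fun.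
      by move=> t; apply: cvgM; [exact: cvg_cst | exact: cH].
    - by apply/measurable_EFinP; apply: measurable_funTS; apply: continuous_measurable_fun.
    move=> t; rewrite /= in_itv/= => /andP[h1 h2].
    (* As m is the midpoint, |t - m| <= L / 2 on [a, b]. *)
    have hw : 3 / 4 <= w t.
      rewrite /w /parabola expr_div_n.
      have : (t - m) ^+ 2 / L ^+ 2 <= 1 / 4; last lra.
      by rewrite ler_pdivrMr ?exprn_gt0//; move: h1 h2; rewrite /m /L; nra.
    rewrite lee_fin; have := ler_wpM2r (mulr_ge0 (ltW pi2) (H0 t)) hw; lra.
  apply: ge0_subset_integral => //.
  - by apply/measurable_EFinP; apply: measurable_funTS; apply: continuous_measurable_fun.
  - move=> t tJ; rewrite lee_fin; apply: mulr_ge0; first by rewrite mulr_ge0// ltW.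
    by rewrite mulr_ge0// w0.
  - apply: subset_itv; rewrite bnd_simp /m /L; lra.
have [F dF Fle] : exists2 F : P * P -> R -> R,
    forall pq (t : R), is_derive t 1 (F pq) (w t * harm (A pq) (B pq) (mu pq * t)) &
    forall pq, `|F pq (m + L) - F pq (m - L)| <=
      kern L (mu pq) * ((sqnorm (z pq.1) + sqnorm (z pq.2)) / 2).
  have /choice[F hF] : forall pq, exists F : R -> R,
    (forall (t : R), is_derive t 1 F (w t * harm (A pq) (B pq) (mu pq * t))) /\
    `|F (m + L) - F (m - L)| <=
      kern L (mu pq) * ((sqnorm (z pq.1) + sqnorm (z pq.2)) / 2).
    move=> pq.
    have [F ? ?] := parabola_primitive (mu pq) m L0
      (cross_re_le (z pq.1) (z pq.2)) (cross_im_le _ _).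
    by exists F.
  by exists F => pq; have [] := hF pq.
pose G t := 4 / 3 * (2 * pi) * \sum_(pq : P * P) if xi pq.1 == xi pq.2 then F pq t else 0.
have dG (t : R) : is_derive t 1 G (4 / 3 * (2 * pi) * (w t * H t)).
  apply: is_derive_scale; rewrite /H mulr_sumr big_mkcond/=.
  apply: is_derive_sum_fin => pq; case: (xi pq.1 == xi pq.2) => //.
  exact: is_derive_cst.
rewrite (FTC_derivable _ cwH dG); last by rewrite ltrD2l; lra.
rewrite lee_fin /G -mulrBr ler_pM2l; last by rewrite mulr_gt0//; lra.
rewrite -sumrB [leRHS]big_mkcond/=; apply: ler_sum => pq _.
case: ifP => _; last by rewrite subrr.
by rewrite (le_trans (ler_norm _)).
Qed.

End Planar.

(** * Schur's test for one pair of sign blocks *)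

Section Block.
Context {R : realType}.

Lemma sum_inv_sqr_le4 (i N : nat) : \sum_(j < N) ((i%:R - j%:R) ^+ 2)^-1 <= 4 :> R.
Proof.
(* The term j = i is 0 because 0^-1 = 0.  The bound telescopes in N. *)
suff : \sum_(j < N) ((i%:R - j%:R) ^+ 2)^-1 <=
  if (N <= i)%N then 2 / (i%:R - N%:R + 1) else 4 - 2 / (N%:R - i%:R) :> R.
  move/le_trans; apply; case: leqP => iN.
    have : 0 <= i%:R - N%:R :> R by rewrite subr_ge0 ler_nat.
    move=> h; rewrite ler_pdivrMr; lra.
  by rewrite lerBlDr lerDl divr_ge0// subr_ge0 ler_nat ltnW.
elim: N => [|N ih]; first by rewrite big_ord0 leq0n divr_ge0// addr_ge0// subr0.
rewrite big_ord_recr/=; case: (ltngtP N i) ih => [Ni|iN|->] ih.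
- have h : 1 <= i%:R - N%:R :> R by rewrite lerBrDr nat1r ler_nat.
  apply: le_trans (lerD ih (lexx _)) _; move: h; rewrite -[N.+1%:R]natr1.
  set d := i%:R - N%:R => h.
  have -> : i%:R - (N%:R + 1) + 1 = d by rewrite /d; ring.
  (* The increment 2 / (d (d + 1)) is at least 1 / d^2 because d >= 1. *)
  have -> : 2 / d = 2 / (d + 1) + 2 / (d * (d + 1)) by field; lra.
  rewrite lerD2l -[leLHS]mul1r ler_pdivrMr ?exprn_gt0//; last lra.
  rewrite mulrAC ler_pdivlMr; nra.
- have h : 1 <= N%:R - i%:R :> R by rewrite lerBrDr nat1r ler_nat.
  apply: le_trans (lerD ih (lexx _)) _; move: h.
  rewrite -[N.+1%:R]natr1 -[(i%:R - N%:R) ^+ 2]sqrrN opprB.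
  set d := N%:R - i%:R => h.
  have -> : N%:R + 1 - i%:R = d + 1 by rewrite /d; ring.
  have -> : 4 - 2 / (d + 1) = 4 - 2 / d + 2 / (d * (d + 1)) by field; lra.
  rewrite lerD2l -[leLHS]mul1r ler_pdivrMr ?exprn_gt0//; last lra.
  rewrite mulrAC ler_pdivlMr; nra.
(* At N = i both formulas for the bound give 2, so it is unchanged when the zero term is added. *)
- rewrite subrr expr0n invr0 addr0; apply: le_trans ih _; rewrite -[i.+1%:R]natr1.
  have -> : i%:R + 1 - i%:R = 1 :> R by ring.
  by rewrite subrr add0r !divr1; lra.
Qed.

(** By symmetry the [e pq.1] half and the [e pq.2] half are equal, and the row sums bound the
    first. *)
Lemma schur_test (P : finType) (Q : rel P) (k : P -> P -> R) (e : P -> R) (S : R) :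
  symmetric Q -> (forall p q, k p q = k q p) -> (forall p, 0 <= e p) ->
  (forall p, \sum_(q | Q p q) k p q <= S) ->
  \sum_(pq : P * P | Q pq.1 pq.2) k pq.1 pq.2 * ((e pq.1 + e pq.2) / 2) <= S * \sum_p e p.
Proof.
move=> sQ sk e0 kS.
have half : \sum_(pq : P * P | Q pq.1 pq.2) k pq.1 pq.2 * e pq.1 <= S * \sum_p e p.
  rewrite mulr_sumr -(pair_big_dep xpredT Q (fun p q => k p q * e p))/=.
  by apply: ler_sum => p _; rewrite -mulr_suml ler_wpM2r.
have half' : \sum_(pq : P * P | Q pq.1 pq.2) k pq.1 pq.2 * e pq.2 =
             \sum_(pq : P * P | Q pq.1 pq.2) k pq.1 pq.2 * e pq.1.
  rewrite -(pair_big_dep xpredT Q (fun p q => k p q * e p))/=.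
  rewrite -(pair_big_dep xpredT Q (fun p q => k p q * e q))/=.
  rewrite (exchange_big_dep xpredT)//=; apply: eq_bigr => p _.
  by apply: eq_big => [q|q _]; [exact: sQ | rewrite sk].
have -> : \sum_(pq : P * P | Q pq.1 pq.2) k pq.1 pq.2 * ((e pq.1 + e pq.2) / 2) =
   2^-1 * (\sum_(pq : P * P | Q pq.1 pq.2) k pq.1 pq.2 * e pq.1 +
     \sum_(pq : P * P | Q pq.1 pq.2) k pq.1 pq.2 * e pq.2).
  by rewrite -big_split mulr_sumr; apply: eq_bigr => pq _ /=; ring.
rewrite half'; lra.
Qed.

(** The prefactor comes from [planar_bound]; 2 is the diagonal value of [kern] divided by L, and 32
    is the 8 in [kern] times the bound 4 on the sum of inverse squares. *)
Definition block_const (eta : R) : R :=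
  4 / 3 * (2 * pi) * (2 + 32 * ((eta ^+ 2)^-1 + (eta ^+ 3)^-1)).

(** Once n i + k j is fixed, i' determines j', so a row of the kernel is a sum over i' alone.
    Separation of the time frequencies makes it decay like 1 / |i - i'|^2, uniformly because (b - a)
    delta >= eta. *)
Lemma block_bound (N K : nat) (u : 'I_N -> R[i]) (v : 'I_K -> R[i])
    (n : 'I_N -> int) (k : 'I_K -> int) (f : 'I_N -> R) (g : 'I_K -> R)
    (a b delta eta : R) :
  a < b -> injective k -> 0 < eta -> eta <= (b - a) * delta ->
  (forall i j i' j', n i + k j = n i' + k j' ->
     delta * `|i%:R - i'%:R| <= `|(f i + g j) - (f i' + g j')|) ->
  (\int[lebesgue_measure \x lebesgue_measure]_(w in `[a, b] `*` torus)
     (sqnorm ((\sum_i u i * expi ((n i)%:~R * w.2 + f i * w.1)) *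
              (\sum_j v j * expi ((k j)%:~R * w.2 + g j * w.1))))%:E <=
   (block_const eta * (b - a) * ((\sum_i sqnorm (u i)) * (\sum_j sqnorm (v j))))%:E)%E.
Proof.
move=> ab kinj eta0 heta sep.
pose z (p : 'I_N * 'I_K) := u p.1 * v p.2.
pose xi (p : 'I_N * 'I_K) := n p.1 + k p.2.
pose lam (p : 'I_N * 'I_K) := f p.1 + g p.2.
under eq_integral => w _.
  rewrite big_distrlr/= pair_big/=.
  under eq_bigr => p _.
    rewrite mulrACA -expiD addrACA -!mulrDl -rmorphD/= -/(z p) -/(xi p) -/(lam p).
    over.
  over.
apply: le_trans (planar_bound z xi lam ab) _.
rewrite lee_fin /block_const -[leRHS]mulrA -[leRHS]mulrA.
apply: ler_wpM2l; first by rewrite !mulr_ge0 ?pi_ge0.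
set L := b - a; have L0 : 0 < L by rewrite subr_gt0.
set c := (eta ^+ 2)^-1 + (eta ^+ 3)^-1.
have c0 : 0 <= c by rewrite addr_ge0// invr_ge0 exprn_ge0// ltW.
have -> : (\sum_i sqnorm (u i)) * (\sum_j sqnorm (v j)) = \sum_p sqnorm (z p).
  by rewrite big_distrlr/= pair_big/=; apply: eq_bigr => p _; rewrite sqnormM.
rewrite mulrA.
apply: (schur_test (Q := fun p q => xi p == xi q) (k := fun p q => kern L (lam p - lam q))).
- by move=> p q; rewrite eq_sym.
- by move=> p q; rewrite -kernN opprB.
- by move=> p; exact: sqnorm_ge0.
move=> [i j].
(* Majorant of the row at i': the diagonal part plus the quadratic decay, whose term at i' = i is 0
   since 0^-1 = 0. *)
pose gm (i' : 'I_N) := (if i' == i then 2 * L else 0) + 8 * L * c * ((i%:R - i'%:R) ^+ 2)^-1.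
apply: (@le_trans _ _ (\sum_i' gm i')); last first.
  rewrite big_split/= -big_mkcond/= big_pred1_eq -mulr_sumr.
  have := ler_wpM2l (mulr_ge0 (mulr_ge0 (ler0n R 8) (ltW L0)) c0) (sum_inv_sqr_le4 i N).
  lra.
rewrite -(pair_big_dep xpredT (fun i' j' => xi (i, j) == xi (i', j'))
  (fun i' j' => kern L (lam (i, j) - lam (i', j'))))/=.
apply: ler_sum => i' _.
have gm0 : 0 <= gm i'.
  rewrite /gm addr_ge0//; first by case: ifP => // _; rewrite mulr_ge0// ltW.
  by rewrite !mulr_ge0 ?invr_ge0 ?sqr_ge0// ltW.
(* Injectivity of [k] leaves at most one j' for each i'. *)
have [j' /eqP Ej'|none] := pickP (fun j' => xi (i, j) == xi (i', j')); last first.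
  by rewrite big_pred0.
rewrite (big_pred1 j') => [|l]; last first.
  rewrite Ej' /xi/= (inj_eq (addrI _)) (inj_eq kinj) eq_sym//.
rewrite /gm; case: eqVneq => [ii|ii].
  have jj : j' = j by apply: kinj; apply: (addrI (n i)); rewrite -{1}ii.
  rewrite ii jj subrr /kern eqxx subrr expr0n invr0 mulr0 addr0//.
rewrite add0r.
have := sep _ _ _ _ Ej'; rewrite -/(lam (i, j)) -/(lam (i', j')).
set l := lam _ - lam _; set d := i%:R - i'%:R => sepl.
have d1 : 1 <= `|d|.
  rewrite /d !pmulrn -intrB -intr_norm -[1]/(1%:~R) ler_int.
  by rewrite -gtz0_ge1 normr_gt0 subr_eq0 eqz_nat eq_sym.
have d2 : 0 < d ^+ 2 by rewrite exprn_even_gt0//= -normr_gt0 (lt_le_trans _ d1).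
have y1 : eta * `|d| <= L * `|l|.
  apply: le_trans (ler_wpM2r (normr_ge0 _) heta) _.
  by rewrite -mulrA ler_wpM2l// ltW.
have y0 : 0 < eta * `|d| by rewrite mulr_gt0// (lt_le_trans _ d1).
have l0 : 0 < `|l| by rewrite -(pmulr_rgt0 _ L0) (lt_le_trans y0).
rewrite /kern -normr_eq0 (gt_eqF l0).
have -> : 8 * L * c * (d ^+ 2)^-1 =
    8 * (L * ((eta ^+ 2 * d ^+ 2)^-1 + (eta ^+ 3 * d ^+ 2)^-1)).
  by rewrite /c !invfM; ring.
rewrite ler_wpM2l// mulrDr; apply: lerD.
  have -> : (L * l ^+ 2)^-1 = L * ((L * `|l|) ^+ 2)^-1.
    by rewrite exprMn real_normK ?num_real// !invfM; field; rewrite -normr_eq0 !gt_eqF.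
  rewrite ler_wpM2l ?(ltW L0)// lef_pV2 ?posrE ?exprn_gt0//.
  - by rewrite -[d ^+ 2]real_normK ?num_real// -exprMn lerXn2r ?nnegrE// ltW// (lt_le_trans y0).
  - by rewrite mulr_gt0.
  - by apply: mulr_gt0 => //; exact: exprn_gt0.
have -> : (L ^+ 2 * `|l| ^+ 3)^-1 = L * ((L * `|l|) ^+ 3)^-1.
  by field; rewrite !gt_eqF.
rewrite ler_wpM2l ?(ltW L0)// lef_pV2 ?posrE ?exprn_gt0//.
- rewrite -[d ^+ 2]real_normK ?num_real//.
  (* Cubic decay is weakened to quadratic decay, using |d| >= 1. *)
  apply: (@le_trans _ _ ((eta * `|d|) ^+ 3)).
    rewrite exprMn; apply: ler_wpM2l; [exact: exprn_ge0 (ltW eta0) | exact: ler_weXn2l].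
  by rewrite lerXn2r ?nnegrE// ltW// (lt_le_trans y0).
- by rewrite mulr_gt0.
- by apply: mulr_gt0 => //; exact: exprn_gt0.
Qed.

End Block.

(** * Dyadic projectors, Parseval's identity and phase separation *)

Section Frequencies.
Context {R : realType}.

Lemma L2norm_sqnorm d (X : measurableType d) (mu : {measure set X -> \bar R})
    (D : set X) (f : X -> R[i]) :
  L2norm mu D f = ((\int[mu]_(x in D) (sqnorm (f x))%:E) `^ 2^-1)%E.
Proof.
rewrite /L2norm unlock [in RHS]integral_mkcond; congr poweR.
apply: eq_integral => x _; rewrite !patchE; case: ifP => _.
  rewrite sqnorm_normc abse_EFin ger0_norm ?sqrtr_ge0// poweR_EFin powR_mulrn ?sqrtr_ge0//.
  by rewrite sqr_sqrtr ?sqnorm_ge0.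
by rewrite abse0 poweR0r.
Qed.

(* Positive frequencies for e = false, negative ones for e = true. *)
Definition freq (N : nat) (e : bool) (i : 'I_N) : int := (-1) ^+ e * (N + i)%:Z.

Lemma freq_inj (N : nat) : (0 < N)%N -> injective (fun p : bool * 'I_N => freq p.1 p.2).
Proof.
move=> N0 [e i] [e' i']; rewrite /freq /= => h.
have [-> /val_inj -> //] : e = e' /\ val i = val i'.
by move: h; case: e; case: e' => /=; rewrite ?expr0 ?expr1 ?mul1r ?mulN1r => h; split; lia.
Qed.

(** Each xi with N <= |xi| < 2 N is uniquely a sign times N + i with i < N. *)
Lemma freq_proj_sum (N : nat) (f : R -> R[i]) (x : R) : (0 < N)%N ->
  freq_proj N f x = \sum_(p : bool * 'I_N)
    fourier_coef f (freq p.1 p.2) * expi ((freq p.1 p.2)%:~R * x).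
Proof.
move=> N0; rewrite /freq_proj.
rewrite -(big_map (fun p : bool * 'I_N => freq p.1 p.2) xpredT
  (fun xi => fourier_coef f xi * expi (xi%:~R * x)))/=.
rewrite [RHS]fsbig_seq; last by rewrite map_inj_uniq ?index_enum_uniq//; exact: freq_inj.
suff -> : freq_range N = [set` [seq freq p.1 p.2 | p <- index_enum (bool * 'I_N)%type]] by [].
apply/seteqP; split => [xi /= /andP[h1 h2]|xi /= /mapP[[e i] _ ->]].
  have hi : (`|xi|%N - N < N)%N by lia.
  apply/mapP; exists (xi < 0, Ordinal hi); first by rewrite mem_index_enum.
  by rewrite /freq /= subnKC//; case: ltP => h; rewrite ?expr1 ?expr0; lia.
rewrite /freq_range /freq /=; have := ltn_ord i.
by case: e; rewrite ?expr1 ?expr0 ?mul1r ?mulN1r; lia.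
Qed.

(** Parseval's identity: distinct frequencies are orthogonal, and the factor 2 pi reflects the
    normalisation of [fourier_coef]. *)
Lemma normL2T_freq_proj (N : nat) (f : R -> R[i]) : (0 < N)%N ->
  normL2T (freq_proj N f) = (Num.sqrt (2 * pi *
    (\sum_(p : bool * 'I_N) sqnorm (fourier_coef f (freq p.1 p.2)))))%:E.
Proof.
move=> N0; rewrite /normL2T L2norm_sqnorm.
set S := \sum_p _.
pose z (p : bool * 'I_N) := fourier_coef f (freq p.1 p.2).
suff -> : (\int[lebesgue_measure]_(x in torus) (sqnorm (freq_proj N f x))%:E)%E
    = (2 * pi * S)%:E.
  rewrite poweR_EFin powR12_sqrt// mulr_ge0 ?mulr_ge0 ?pi_ge0//.
  by apply: sumr_ge0 => p _; exact: sqnorm_ge0.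
transitivity (\int[lebesgue_measure]_(x in torus)
  (\sum_(pq : (bool * 'I_N) * (bool * 'I_N))
    harm (cross_re (z pq.1) (z pq.2)) (cross_im (z pq.1) (z pq.2))
      ((freq pq.1.1 pq.1.2 - freq pq.2.1 pq.2.2)%:~R * x + 0))%:E)%E.
  apply: eq_integral => x _; rewrite freq_proj_sum// sqnorm_sum_expi; congr EFin.
  by apply: eq_bigr => pq _; rewrite addr0 rmorphB/= mulrBl.
rewrite (integral_torus_harm _ _ (fun pq => freq pq.1.1 pq.1.2 - freq pq.2.1 pq.2.2) (fun=> 0)).
congr (_ * _)%:E; rewrite /S.
rewrite -(pair_big_dep xpredT (fun p q => freq p.1 p.2 - freq q.1 q.2 == 0)
  (fun p q => harm (cross_re (z p) (z q)) (cross_im (z p) (z q)) 0))/=.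
apply: eq_bigr => p _; rewrite (big_pred1 p) => [|q]; last first.
  by rewrite subr_eq0 (inj_eq (freq_inj N0) p q) eq_sym.
by rewrite /harm cos0 sin0 /cross_re /sqnorm -!expr2 -/(z p); ring.
Qed.

Lemma derive_separation (h dh : R -> R) (delta y1 y2 : R) :
  (forall x : R, is_derive x 1 h (dh x)) ->
  (forall x, (y1 <= x <= y2) || (y2 <= x <= y1) -> delta <= `|dh x|) ->
  delta * `|y1 - y2| <= `|h y1 - h y2|.
Proof.
move=> dhP; wlog y12 : y1 y2 / y1 <= y2 => [wl hd|hd].
  have [|/ltW] := leP y1 y2; first by move/wl; exact.
  move/wl => wl'; rewrite distrC [`|h _ - _|]distrC; apply: wl' => x; rewrite orbC; exact: hd.
have ch : continuous h by exact: is_derive_continuous dhP.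
have [|x xI E] := @MVT_segment _ h dh _ _ y12.
  exact: continuous_subspaceT.
rewrite distrC [`|h _ - _|]distrC E normrM ler_wpM2r// hd//.
by move: xI; rewrite in_itv/= => ->.
Qed.

(** A dyadic range restricted to one sign is an interval. With both signs the segment could cross 0,
    which is why frequencies are split by sign. *)
Lemma between_range (e : bool) (M : nat) (y1 y2 x : R) : (0 < M)%N ->
  M%:R <= (-1) ^+ e * y1 < 2 * M%:R -> M%:R <= (-1) ^+ e * y2 < 2 * M%:R ->
  (y1 <= x <= y2) || (y2 <= x <= y1) -> M%:R <= `|x| < 2 * M%:R.
Proof.
rewrite -(ltr_nat R); move: (M%:R) => m m0 /andP[a1 a2] /andP[b1 b2] /orP h.
have -> : `|x| = (-1) ^+ e * x.
  case: e a1 a2 b1 b2; rewrite ?expr1 ?expr0 => *.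
    by rewrite ler0_norm ?mulN1r//; case: h => /andP[]; lra.
  by rewrite ger0_norm ?mul1r//; case: h => /andP[]; lra.
by case: e a1 a2 b1 b2; rewrite ?expr1 ?expr0 => *; case: h => /andP[*]; apply/andP; split; lra.
Qed.

Lemma freq_range_sign (N : nat) (e : bool) (i : 'I_N) :
  (N%:R : R) <= (-1) ^+ e * ((freq e i)%:~R : R) < 2 * (N%:R : R).
Proof.
rewrite /freq rmorphM rmorphXn rmorphN1/= mulrA -expr2 sqrr_sign mul1r -pmulrn.
by rewrite -natrM ler_nat ltr_nat leq_addr/=; have := ltn_ord i; lia.
Qed.

(** With the total frequency X fixed, both phases are values of one function h of the high frequency
    y, the low one being X - y. Between the two values of y, both y and X - y stay in their dyadic
    ranges, so transversality bounds h' from below. *)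
Lemma phase_separation (phi : R -> R) (delta : R) (K N : nat) (s1 s2 e1 e2 : bool) :
  (0 < K)%N -> (0 < N)%N -> (forall x, derivable phi x 1) ->
  (forall xi1 xi2 : R, K%:R <= `|xi1| < 2 * K%:R -> N%:R <= `|xi2| < 2 * N%:R ->
    forall s : bool, delta <= `|derive1 phi xi1 + (-1) ^+ s * derive1 phi xi2|) ->
  forall (i : 'I_N) (j : 'I_K) (i' : 'I_N) (j' : 'I_K),
  freq e1 i + freq e2 j = freq e1 i' + freq e2 j' ->
  delta * `|i%:R - i'%:R| <=
   `|((-1) ^+ s1 * phi (freq e1 i)%:~R + (-1) ^+ s2 * phi (freq e2 j)%:~R) -
     ((-1) ^+ s1 * phi (freq e1 i')%:~R + (-1) ^+ s2 * phi (freq e2 j')%:~R)|.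
Proof.
move=> K0 N0 dphi tr i j i' j' E.
pose X : R := (freq e1 i + freq e2 j)%:~R.
have Ej : (freq e2 j)%:~R = X - (freq e1 i)%:~R by rewrite /X rmorphD/=; ring.
have Ej' : (freq e2 j')%:~R = X - (freq e1 i')%:~R by rewrite /X E rmorphD/=; ring.
pose h y := (-1) ^+ s1 * phi y + (-1) ^+ s2 * phi (X - y).
pose dh y := (-1) ^+ s1 * derive1 phi y - (-1) ^+ s2 * derive1 phi (X - y).
have dphi' (y : R) : is_derive y 1 phi (derive1 phi y).
  by rewrite derive1E; exact: derivableP.
have dhP (y : R) : is_derive y 1 h (dh y).
  have d1 := is_derive_affine (-1) X y.
  have d2 := @is_derive1_comp _ phi (fun y => -1 * y + X) _ _ _ (dphi' _) d1.
  have -> : h = fun y => (-1) ^+ s1 * phi y + (-1) ^+ s2 * (phi \o (fun y => -1 * y + X)) y.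
    by apply/funext => v; rewrite /h /= mulN1r [- v + _]addrC.
  apply: is_derive_eq (is_derive_add (is_derive_scale _ (dphi' y)) (is_derive_scale _ d2)) _.
  by rewrite /dh mulN1r [- y + _]addrC; ring.
have -> : `|i%:R - i'%:R| = `|(freq e1 i)%:~R - (freq e1 i')%:~R| :> R.
  rewrite /freq -rmorphB -mulrBr rmorphM rmorphXn rmorphN1/= normrM normrX normrN1 expr1n mul1r.
  rewrite rmorphB/= -!pmulrn !natrD; congr `|_|; ring.
rewrite Ej Ej' -/(h _) -/(h _).
apply: derive_separation dhP _ => x hx.
have r2 := (between_range N0 (freq_range_sign e1 i) (freq_range_sign e1 i') hx).
have r1 : K%:R <= `|X - x| < 2 * K%:R.
  apply: (@between_range e2 _ (X - (freq e1 i)%:~R) (X - (freq e1 i')%:~R)) => //.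
  - by rewrite -Ej freq_range_sign.
  - by rewrite -Ej' freq_range_sign.
  by rewrite !lerD2l !lerN2; case/orP: hx => /andP[-> ->]; rewrite ?orbT.
(* The derivative of X - y contributes a minus sign: equal signs s1, s2 lead to a difference of the
   phi', opposite signs to a sum, up to a global sign. *)
apply: le_trans (tr _ _ r1 r2 (~~ (s1 (+) s2))) _.
rewrite /dh; move: (derive1 phi x) (derive1 phi (X - x)) => p q; clear.
case: s1; case: s2; rewrite /= ?expr0 ?expr1.
- by rewrite le_eqVlt; apply/orP; left; apply/eqP; congr `|_|; ring.
- by rewrite -normrN le_eqVlt; apply/orP; left; apply/eqP; congr `|_|; ring.
- by rewrite le_eqVlt; apply/orP; left; apply/eqP; congr `|_|; ring.
- by rewrite -normrN le_eqVlt; apply/orP; left; apply/eqP; congr `|_|; ring.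
Qed.

End Frequencies.

(** * Assembly of the bilinear estimate *)

Lemma dyadic_gt0 (N : nat) : dyadic N -> (0 < N)%N.
Proof. by move=> [j ->]; rewrite expn_gt0. Qed.

(** The projection depends only on Fourier coefficients, so it is known at every point although
    [U t] is an arbitrary representative. *)
Lemma freq_proj_propagation (R : realType) (s : bool) (phi : R -> R) (u0 : R -> R[i])
    (U : R -> R -> R[i]) (N : nat) (t x : R) : (0 < N)%N -> propagation s phi u0 U ->
  freq_proj N (U t) x = \sum_(p : bool * 'I_N) fourier_coef u0 (freq p.1 p.2) *
    expi ((freq p.1 p.2)%:~R * x + (-1) ^+ s * phi (freq p.1 p.2)%:~R * t).
Proof.
move=> N0 hU; rewrite freq_proj_sum//; apply: eq_bigr => p _.
have [_ ->] := hU t.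
have -> : (-1) ^+ s * phi (freq p.1 p.2)%:~R * t = (-1) ^+ s * (t * phi (freq p.1 p.2)%:~R).
  by rewrite -mulrA [t * _]mulrC.
by rewrite expiD; ring.
Qed.

(** Splitting each of the two factors by sign costs a factor 2. *)
Lemma sqnorm_sum_boolM (R : realType) (u v : bool -> R[i]) :
  sqnorm ((\sum_e u e) * (\sum_e v e)) <=
  \sum_(p : bool * bool) 4 * sqnorm (u p.1 * v p.2).
Proof.
rewrite sqnormM !big_bool/=.
have -> : \sum_(p : bool * bool) 4 * sqnorm (u p.1 * v p.2) =
   2 * (sqnorm (u true) + sqnorm (u false)) * (2 * (sqnorm (v true) + sqnorm (v false))).
  rewrite -(pair_bigA _ (fun e e' => 4 * sqnorm (u e * v e')))/= !big_bool/= !sqnormM; ring.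
by rewrite ler_pM ?sqnorm_ge0// sqnormD.
Qed.

Theorem proposition1p4 (R : realType) (phi : R -> R) (alpha c c0 : R) :
  C2 phi -> 0 < alpha -> 0 < c -> transversality c alpha phi -> 0 < c0 ->
  exists2 C : R, 0 < C &
    forall (s1 s2 : bool) (K N : nat),
      dyadic K -> dyadic N -> much_less c K N ->
    forall (u0 v0 : R -> R[i]) (U V : R -> R -> R[i]),
      L2T u0 -> L2T v0 -> propagation s1 phi u0 U -> propagation s2 phi v0 V ->
    forall a b : R, a <= b -> c0 * N%:R `^ (- alpha) <= b - a ->
    (L2norm (lebesgue_measure \x lebesgue_measure)%E (`[a, b] `*` torus)
       (fun tx => freq_proj N (U tx.1) tx.2 * freq_proj K (V tx.1) tx.2)%R
     <= (C * Num.sqrt (b - a))%:E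
        * normL2T (freq_proj N u0) * normL2T (freq_proj K v0))%E.
Proof.
move=> [dphi _ _] _ _ [A [B [A0 _ tr]]] c0_gt0.
(* Lower bound for (b - a) A N^alpha, independent of N. *)
pose eta := A * c0; have eta0 : 0 < eta by rewrite mulr_gt0.
have pi2 : 0 < 2 * pi :> R by rewrite mulr_gt0 ?pi_gt0.
have bc0 : 0 < block_const eta.
  rewrite /block_const mulr_gt0//; first by rewrite mulr_gt0//; lra.
  by rewrite ltr_pwDl// mulr_ge0// addr_ge0// invr_ge0 exprn_ge0// ltW.
(* The 4 pays for the sign splitting; (2 pi)^2 cancels the Parseval factors of the two data. *)
exists (Num.sqrt (4 * block_const eta / (2 * pi) ^+ 2)).
  by rewrite sqrtr_gt0; apply: divr_gt0; [rewrite mulr_gt0 | exact: exprn_gt0].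
move=> s1 s2 K N dK dN KN u0 v0 U V _ _ hU hV a b _ hab.
have K0 := dyadic_gt0 dK; have N0 := dyadic_gt0 dN.
set delta := A * N%:R `^ alpha.
have Na0 : 0 < N%:R `^ alpha by rewrite powR_gt0// ltr0n.
have ab : a < b.
  by rewrite -subr_gt0; apply: lt_le_trans hab; rewrite mulr_gt0// powR_gt0// ltr0n.
have hdelta : eta <= (b - a) * delta.
  move: hab; rewrite powRN ler_pdivrMr// /delta /eta => hab.
  by rewrite [A * _ `^ _]mulrC mulrA mulrC ler_wpM2r// ltW.
have trN (xi1 xi2 : R) : K%:R <= `|xi1| < 2 * K%:R -> N%:R <= `|xi2| < 2 * N%:R ->
    forall s : bool, delta <= `|derive1 phi xi1 + (-1) ^+ s * derive1 phi xi2|.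
  by move=> h1 h2 s; have /andP[] := tr K N dK dN KN xi1 xi2 h1 h2 s.
have sep e1 e2 := @phase_separation R phi delta K N s1 s2 e1 e2 K0 N0 dphi trN.
pose u e (w : R * R) := \sum_(i < N) fourier_coef u0 (freq e i) *
    expi ((freq e i)%:~R * w.2 + (-1) ^+ s1 * phi (freq e i)%:~R * w.1).
pose v e (w : R * R) := \sum_(i < K) fourier_coef v0 (freq e i) *
    expi ((freq e i)%:~R * w.2 + (-1) ^+ s2 * phi (freq e i)%:~R * w.1).
pose Su e := \sum_(i < N) sqnorm (fourier_coef u0 (freq e i)).
pose Sv e := \sum_(i < K) sqnorm (fourier_coef v0 (freq e i)).
have finj M (e : bool) : injective (fun i : 'I_M => freq e i).
  move=> i i' /(congr1 (fun z => (-1) ^+ e * z)); rewrite /freq !mulrA -expr2 sqrr_sign.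
  by rewrite !mul1r => -[] /addnI /val_inj.
set I := (\int[lebesgue_measure \x lebesgue_measure]_(w in `[a, b] `*` torus)
   (sqnorm (freq_proj N (U w.1) w.2 * freq_proj K (V w.1) w.2))%:E)%E.
(* Joint measurability in (t, x) comes from the explicit exponential sums, since [propagation]
   constrains each time separately. *)
have mG : measurable_fun setT (fun w : R * R =>
    (sqnorm (freq_proj N (U w.1) w.2 * freq_proj K (V w.1) w.2))%:E).
  apply/measurable_EFinP.
  under eq_fun do rewrite sqnormM (freq_proj_propagation _ _ N0 hU)
    (freq_proj_propagation _ _ K0 hV).
  by apply: measurable_funM; apply: measurable_sqnorm_sum_expi => p; exact: measurable_phase.
have muv (p : bool * bool) : measurable_fun setT (fun w : R * R => sqnorm (u p.1 w * v p.2 w)).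
  under eq_fun do rewrite sqnormM.
  by apply: measurable_funM; apply: measurable_sqnorm_sum_expi => i; exact: measurable_phase.
have muv4 (p : bool * bool) : measurable_fun setT (fun w : R * R =>
    (4 * sqnorm (u p.1 w * v p.2 w))%:E).
  by apply/measurable_EFinP; exact: measurable_funM.
have mD : measurable (`[a, b]%classic `*` (torus : set R)).
  by apply: measurableX; exact: measurable_itv.
(* The four pairs of signs are treated separately by [block_bound]; their bounds add up to the
   product of the full coefficient sums. *)
have I_le : (I <= (4 * block_const eta * (b - a) * ((\sum_e Su e) * (\sum_e Sv e)))%:E)%E.
  apply: (@le_trans _ _ (\int[lebesgue_measure \x lebesgue_measure]_(w in `[a, b] `*` torus)
     \sum_(p : bool * bool) (4 * sqnorm (u p.1 w * v p.2 w))%:E)%E).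
    apply: ge0_le_integral => //.
    - by move=> w _; rewrite lee_fin sqnorm_ge0.
    - exact: measurable_funTS.
    - by apply: measurable_funTS; exact: emeasurable_sum.
    move=> w _; rewrite sumEFin lee_fin.
    rewrite (freq_proj_propagation _ _ N0 hU) (freq_proj_propagation _ _ K0 hV).
    have := sqnorm_sum_boolM (u ^~ w) (v ^~ w).
    by rewrite !pair_big.
  rewrite ge0_integral_sum//; last 2 first.
  - by move=> p; apply: measurable_funTS; exact: muv4.
  - by move=> p w _; rewrite lee_fin mulr_ge0// sqnorm_ge0.
  rewrite big_distrlr/= pair_big/= mulr_sumr -sumEFin.
  apply: lee_sum => -[e1 e2] _ /=.
  under eq_integral do rewrite EFinM.
  rewrite ge0_integralZl//; last 2 first.
  - by apply/measurable_EFinP; apply: measurable_funTS; exact: (muv (e1, e2)).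
  - by move=> w _; rewrite lee_fin sqnorm_ge0.
  rewrite -2!(mulrA 4) EFinM lee_wpmul2l//.
  exact: block_bound ab (finj _ e2) eta0 hdelta (sep e1 e2).
rewrite L2norm_sqnorm -/I !normL2T_freq_proj// -!EFinM.
have Su0 : 0 <= \sum_e Su e by apply: sumr_ge0 => e _; apply: sumr_ge0 => i _; exact: sqnorm_ge0.
have Sv0 : 0 <= \sum_e Sv e by apply: sumr_ge0 => e _; apply: sumr_ge0 => i _; exact: sqnorm_ge0.
rewrite -!(pair_bigA _ (fun e i => sqnorm (fourier_coef _ (freq e i))))/=.
rewrite -/(Su _) -/(Sv _).
have -> : Num.sqrt (4 * block_const eta / (2 * pi) ^+ 2) * Num.sqrt (b - a) *
   Num.sqrt (2 * pi * \sum_e Su e) * Num.sqrt (2 * pi * \sum_e Sv e) =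
   Num.sqrt (4 * block_const eta * (b - a) * ((\sum_e Su e) * (\sum_e Sv e))).
  move: (2 * pi) pi2 (block_const eta) bc0 => q q0 bc bc0'.
  rewrite -!sqrtrM ?mulr_ge0 ?invr_ge0 ?exprn_ge0 ?subr_ge0 ?(ltW bc0') ?(ltW ab) ?(ltW q0)//.
  by congr Num.sqrt; field; rewrite lt0r_neq0.
rewrite -powR12_sqrt; last first.
  by rewrite mulr_ge0 ?(mulr_ge0 Su0 Sv0)// mulr_ge0 ?subr_ge0 ?(ltW ab)// mulr_ge0// ltW.
have I0 : (0 <= I)%E by apply: integral_ge0 => w _; rewrite lee_fin sqnorm_ge0.
rewrite -poweR_EFin; apply: gt0_ler_poweR => //.
- by rewrite in_itv/= I0 leey.
- by rewrite in_itv/= (le_trans I0 I_le) leey.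
Qed.
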